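(* Let $\mathbb{S}=\{S^i:i\in I\}$ be a market of nonnegative semimartingales and let $T\in(0,\infty)$. Suppose that $S^i_0>0$ for some $i\in I$, and let $(\mathcal{K}_\alpha)_{\alpha\geq0}$ be one of the families $$(\mathcal{P}_{{\rm sf},\alpha}(\mathbb{S}))_{\alpha\geq0},\quad(\mathcal{P}^{\rm adm}_{{\rm sf},\alpha}(\mathbb{S}))_{\alpha\geq0},\quad(\mathcal{P}^{+}_{{\rm sf},\alpha}(\mathbb{S}))_{\alpha\geq0}.$$ If $\mathcal{K}_1$ satisfies NA$_1$, then $\mathcal{K}_0$ satisfies NA.
   Context: Let $(\Omega,\mathcal{F},(\mathcal{F}_t)_{t\in\mathbb{R}_+},\mathbb{P})$ be a stochastic basis satisfying the usual conditions with $\mathcal{F}_0$ $\mathbb{P}$-trivial; processes are identified up to indistinguishability. $I\neq\emptyset$ is an arbitrary index set and $(S^i)_{i\in I}$ are real-valued semimartingales with $S^i\geq0$. For an $\mathbb{R}^d$-valued semimartingale $X$, $L(X)$ is the set of (predictable) $X$-integrable processes in the sense of vector stochastic integration and $\delta\bullet X$ the stochastic integral (with $(\delta\bullet X)_0=0$). A strategy for $\mathbb{S}$ is a process $\delta=(\delta^i)_{i\in I}$ such that $F:=\{i\in I:\delta^i\neq0\}$ is finite and $\delta^F=(\delta^i)_{i\in F}\in L(S^F)$, $S^F=(S^i)_{i\in F}$; $\Delta(\mathbb{S})$ is the set of strategies. Put $\delta\bullet S:=\delta^F\bullet S^F$ and $S^\delta:=\sum_{i\in F}\delta^iS^i$.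 $\delta$ is self-financing if $S^\delta=S^\delta_0+\delta\bullet S$; $\Delta_{\rm sf}(\mathbb{S})$ is the set of self-financing strategies. A process $X$ is admissible if $X\geq-a$ for some constant $a\in\mathbb{R}_+$. For $\alpha\geq0$: $\mathbb{P}_{{\rm sf},\alpha}(\mathbb{S}):=\{S^\delta:\delta\in\Delta_{\rm sf}(\mathbb{S}),\ S^\delta_0=\alpha\}$, $\mathbb{P}^{\rm adm}_{{\rm sf},\alpha}(\mathbb{S})$ is its subset of admissible processes and $\mathbb{P}^+_{{\rm sf},\alpha}(\mathbb{S})$ its subset of processes $X\geq0$. $\mathcal{P}_{{\rm sf},\alpha}(\mathbb{S}),\mathcal{P}^{\rm adm}_{{\rm sf},\alpha}(\mathbb{S}),\mathcal{P}^+_{{\rm sf},\alpha}(\mathbb{S})$ consist of the terminal values $X_T$ of the processes $X$ in the corresponding set; they are subsets of $L^0=L^0(\Omega,\mathcal{F}_T,\mathbb{P})$ (a.s. equivalence classes, a.s. order). Let $\mathcal{B}:=(\mathcal{K}_1-L^0_+)\cap L^0_+$ and $p_{\mathcal{B}}(\xi):=\inf\{\alpha>0:\xi\in\alpha\mathcal{B}\}\in[0,\infty]$. $\mathcal{K}_1$ satisfies NA$_1$ if $p_{\mathcal{B}}(\xi)>0$ for all $\xi\in L^0_+\setminus\{0\}$. $\mathcal{K}_0$ satisfies NA if $\mathcal{K}_0\cap L^0_+=\{0\}$. *)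

(* Defs.v *)
From HB Require Import structures.
From mathcomp Require Import all_boot all_order all_algebra finmap.
From mathcomp Require Import all_classical all_reals all_analysis.

Set Implicit Arguments.
Unset Strict Implicit.
Unset Printing Implicit Defensive.

Import Order.TTheory GRing.Theory Num.Theory.
Import numFieldNormedType.Exports.

Local Open Scope classical_set_scope.
Local Open Scope ring_scope.

(* A process is a function R -> Omega -> R of which only the times t >= 0
   are meaningful; a filtration is a family R -> set (set Omega), used for
   t >= 0 only.  Statements about processes hold up to indistinguishability. *)

Section StochasticBasis.
Context {d : measure_display} {Omega : measurableType d} {R : realType}.
Variables (P : probability Omega R) (Ft : R -> set (set Omega)).
Implicit Types (X Y M V : R -> Omega -> R) (tau : Omega -> \bar R).

Record usual_basis : Prop := {
  ub_sigma : forall t, 0 <= t -> sigma_algebra setT (Ft t);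
  ub_sub : forall t, 0 <= t -> Ft t `<=` measurable;
  ub_mono : forall s t, 0 <= s -> s <= t -> Ft s `<=` Ft t;
  ub_right : forall t, 0 <= t -> \bigcap_(u in [set u | t < u]) Ft u `<=` Ft t;
  ub_complete : forall N, P.-negligible N -> Ft 0 N
}.

Definition trivial_mod (G : set (set Omega)) : Prop :=
  forall A, G A -> P A = 0%E \/ P A = 1%E.

Definition measurable_for (G : set (set Omega)) (xi : Omega -> R) : Prop :=
  forall B, measurable B -> G (xi @^-1` B).

Definition indist X Y : Prop :=
  {ae P, forall w, forall t, 0 <= t -> X t w = Y t w}.

Definition adapted X : Prop := forall t, 0 <= t -> measurable_for (Ft t) (X t).

Definition cadlag X : Prop :=
  {ae P, forall w,
    (forall t, 0 <= t -> X ^~ w @ t^'+ --> X t w) /\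
    (forall t, 0 < t -> cvg (X ^~ w @ t^'-))}.

Definition martingale M : Prop :=
  [/\ adapted M,
      forall t, 0 <= t -> P.-integrable setT (EFin \o M t)
    & forall s t A, 0 <= s -> s <= t -> Ft s A ->
        (\int[P]_(w in A) (M t w)%:E = \int[P]_(w in A) (M s w)%:E)%E].

Definition stopping_time tau : Prop :=
  (forall w, (0 <= tau w)%E) /\
  (forall t, 0 <= t -> Ft t [set w | (tau w <= t%:E)%E]).

Definition stopped X tau : R -> Omega -> R :=
  fun t w => X (fine (mine t%:E (tau w))) w.

Definition local_martingale M : Prop :=
  [/\ adapted M, cadlag M &
    exists tau : nat -> Omega -> \bar R,
      [/\ forall n, stopping_time (tau n),
          {ae P, forall w, nondecreasing_seq (tau ^~ w) /\
                           tau ^~ w @ \oo --> +oo%E}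
        & forall n, martingale (stopped M (tau n))]].

Definition finite_variation V : Prop :=
  [/\ adapted V, cadlag V &
    {ae P, forall w, forall t, 0 <= t -> bounded_variation 0 t (V ^~ w)}].

Definition semimartingale X : Prop :=
  exists M V, [/\ local_martingale M, finite_variation V &
    indist X (fun t w => M t w + V t w)].

Definition predictable_rectangle : set (set (R * Omega)) :=
  [set D | (exists2 A, Ft 0 A & D = [set 0] `*` A) \/
           (exists s t A, [/\ 0 <= s, Ft s A & D = `]s, t] `*` A])].

Definition predictable X : Prop :=
  forall B, measurable B ->
    <<s [set p : R * Omega | 0 <= p.1], predictable_rectangle >>
      ([set p : R * Omega | 0 <= p.1] `&` (fun p => X p.1 p.2) @^-1` B).

End StochasticBasis.

(* The vector stochastic integral, following Emery, Memin and
   Chou-Meyer-Stricker: first simple integrands, then bounded predictable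
   integrands by dominated convergence, then general predictable integrands by
   limits in the semimartingale (Emery) topology.  Integrals are over ]0, t], so
   the values of an integrand at time 0 are irrelevant. *)
Section VectorIntegral.
Context {d : measure_display} {Omega : measurableType d} {R : realType}.
Variables (P : probability Omega R) (Ft : R -> set (set Omega)).

(* the elementary integrand c 1_A 1_{]s, e]} with A in F_s *)
Record simple_term := SimpleTerm {
  st_start : R;
  st_end : R;
  st_event : set Omega;
  st_coef : R;
  st_start_ge0 : 0 <= st_start;
  st_start_le_end : st_start <= st_end;
  st_eventP : Ft st_start st_event
}.

Definition simple_process (K : seq simple_term) : R -> Omega -> R :=
  fun t w => \sum_(k <- K)
    st_coef k * \1_(st_event k) w * \1_(`]st_start k, st_end k]) t.

Definition simple_integral (K : seq simple_term) (X : R -> Omega -> R) :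
    R -> Omega -> R :=
  fun t w => \sum_(k <- K) st_coef k * \1_(st_event k) w *
    (X (Num.min (st_end k) t) w - X (Num.min (st_start k) t) w).

(* Outer-probability form of P (~ Q) <= eta, so that no measurability of Q has
   to be established first. *)
Definition holds_outside (eta : R) (Q : set Omega) : Prop :=
  exists A, [/\ measurable A, (P A <= eta%:E)%E & ~` A `<=` Q].

Definition sup_upto_le (t e : R) (X : R -> Omega -> R) : set Omega :=
  [set w | forall u, 0 <= u -> u <= t -> `|X u w| <= e].

Definition ucp_cvg (Yn : nat -> R -> Omega -> R) (Y : R -> Omega -> R) : Prop :=
  forall t e eta : R, 0 <= t -> 0 < e -> 0 < eta ->
    \forall n \near \oo,
      holds_outside eta (sup_upto_le t e (fun u w => Yn n u w - Y u w)).

(* Convergence of K . (Yn - Y) to 0, uniformly on compacts in probability and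
   uniformly over the simple K with |K| <= 1.  It does not see initial values. *)
Definition emery_cvg (Yn : nat -> R -> Omega -> R) (Y : R -> Omega -> R) :
    Prop :=
  forall t e eta : R, 0 <= t -> 0 < e -> 0 < eta ->
    \forall n \near \oo, forall K : seq simple_term,
      (forall u w, 0 < u -> `|simple_process K u w| <= 1) ->
      holds_outside eta (sup_upto_le t e
        (simple_integral K (fun u w => Yn n u w - Y u w))).

Section Integrator.
Context {I : choiceType}.
(* the R^F-valued integrator X^F and integrands H^F; coordinates outside F are
   ignored *)
Variables (F : {fset I}) (X : I -> R -> Omega -> R).

(* bounded_integral H Y: "H^F is bounded predictable and Y = H^F . X^F", the
   least relation that contains the simple integrals and is closed under bounded
   pointwise convergence of the integrands with ucp convergence of the
   integrals.  For a semimartingale X, the monotone class theorem and dominated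
   convergence give exactly one Y, up to indistinguishability, for each H. *)
Inductive bounded_integral :
    (I -> R -> Omega -> R) -> (R -> Omega -> R) -> Prop :=
| bounded_integral_simple (K : I -> seq simple_term) :
    bounded_integral (fun i => simple_process (K i))
      (fun t w => \sum_(i <- F) simple_integral (K i) (X i) t w)
| bounded_integral_lim (Hn : nat -> I -> R -> Omega -> R)
    (Yn : nat -> R -> Omega -> R) (H : I -> R -> Omega -> R)
    (Y : R -> Omega -> R) (C : R) :
    (forall n, bounded_integral (Hn n) (Yn n)) ->
    (forall n i t w, i \in F -> 0 < t -> `|Hn n i t w| <= C) ->
    (forall i t w, i \in F -> 0 < t -> Hn n i t w @[n --> \oo] --> H i t w) ->
    ucp_cvg Yn Y ->
    bounded_integral H Y.

(* stoch_integral H Z: "H^F is in L(X^F) and Z = H^F . X^F".  As the space of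
   stochastic integrals with respect to X^F is closed in the Emery topology, any
   approximating sequence yields the same Z as the truncations
   H 1_{|H| <= n}. *)
Definition stoch_integral (H : I -> R -> Omega -> R) (Z : R -> Omega -> R) :
    Prop :=
  (forall i, i \in F -> predictable Ft (H i)) /\
  exists (Hn : nat -> I -> R -> Omega -> R) (Yn : nat -> R -> Omega -> R),
    [/\ forall n, bounded_integral (Hn n) (Yn n),
        forall i t w, i \in F -> 0 < t -> Hn n i t w @[n --> \oo] --> H i t w,
        emery_cvg Yn Z
      & {ae P, forall w, Z 0 w = 0}].

End Integrator.
End VectorIntegral.

Section Market.
Context {d : measure_display} {Omega : measurableType d} {R : realType}
  {I : choiceType}.
Variables (P : probability Omega R) (Ft : R -> set (set Omega)).
Variable S : I -> R -> Omega -> R.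
Implicit Types (delta : I -> R -> Omega -> R).

Definition strategy_support delta : set I :=
  [set i | ~ indist P (delta i) (fun _ _ => 0)].

Definition strategy delta : Prop :=
  finite_set (strategy_support delta) /\
  exists Z, stoch_integral P Ft (fset_set (strategy_support delta)) S delta Z.

Definition wealth delta : R -> Omega -> R :=
  fun t w => \sum_(i <- fset_set (strategy_support delta))
    delta i t w * S i t w.

Definition self_financing delta : Prop :=
  strategy delta /\
  exists Z, stoch_integral P Ft (fset_set (strategy_support delta)) S delta Z /\
    indist P (wealth delta) (fun t w => wealth delta 0 w + Z t w).

Definition nonneg_process (X : R -> Omega -> R) : Prop :=
  {ae P, forall w, forall t, 0 <= t -> 0 <= X t w}.

Definition admissible (X : R -> Omega -> R) : Prop :=
  exists2 a : R, 0 <= a &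
    {ae P, forall w, forall t, 0 <= t -> - a <= X t w}.

Definition Psf (alpha : R) : set (R -> Omega -> R) :=
  [set X | exists delta, [/\ self_financing delta,
    {ae P, forall w, wealth delta 0 w = alpha} & indist P X (wealth delta)]].

Definition Psf_adm (alpha : R) : set (R -> Omega -> R) :=
  Psf alpha `&` admissible.

Definition Psf_pos (alpha : R) : set (R -> Omega -> R) :=
  Psf alpha `&` nonneg_process.

End Market.

(* L^0(Omega, G, P) is represented by the set of G-measurable functions; its
   subsets are represented by sets of functions closed under a.s. equality. *)
Section Arbitrage.
Context {d : measure_display} {Omega : measurableType d} {R : realType}.
Variables (P : probability Omega R) (G : set (set Omega)).

Definition L0 : set (Omega -> R) := [set xi | measurable_for G xi].

Definition L0_zero : set (Omega -> R) :=
  [set xi | L0 xi /\ {ae P, forall w, xi w = 0}].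

Definition L0_pos : set (Omega -> R) :=
  [set xi | L0 xi /\ {ae P, forall w, 0 <= xi w}].

Definition terminal_values (T : R) (X : set (R -> Omega -> R)) :
    set (Omega -> R) :=
  [set xi | L0 xi /\ exists2 Y, X Y & {ae P, forall w, xi w = Y T w}].

(* (K - L^0_+) `&` L^0_+ *)
Definition gaugeB (K : set (Omega -> R)) : set (Omega -> R) :=
  [set (fun w => k w - l w) | k in K & l in L0_pos] `&` L0_pos.

Definition gauge (B : set (Omega -> R)) (xi : Omega -> R) : \bar R :=
  ereal_inf [set a%:E | a in
    [set a : R | 0 < a /\ [set (fun w => a * eta w) | eta in B] xi]].

Definition NA1 (K1 : set (Omega -> R)) : Prop :=
  forall xi, L0_pos xi -> ~ L0_zero xi -> (0 < gauge (gaugeB K1) xi)%E.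

Definition NA (K0 : set (Omega -> R)) : Prop := K0 `&` L0_pos = L0_zero.

End Arbitrage.

(* Main.v *)
(** Let [xi >= 0] be the terminal value of a self-financing wealth process [X]
    with [X_0 = 0].  Since [F_0] is trivial, [S^i_0] is a constant [s0 > 0]
    for some [i], and [b X + S^i / s0] is, for every [b > 0], the wealth process
    of a self-financing strategy with initial value 1, admissible (nonnegative)
    if [X] is.  As [S^i_T >= 0], this gives [b xi] in [(K_1 - L^0_+) /\ L^0_+],
    hence a gauge of at most [1 / b]; letting [b] grow, NA_1 forces [xi = 0]. *)
Require Import Defs.
From mathcomp Require Import all_boot all_order all_algebra finmap.
From mathcomp Require Import all_classical all_reals all_analysis.
From mathcomp Require Import measurable_realfun.

Import Order.TTheory GRing.Theory Num.Theory.
Import numFieldNormedType.Exports.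
Local Open Scope classical_set_scope.
Local Open Scope ring_scope.

Set Implicit Arguments.
Unset Strict Implicit.

(** * Measurability for a sub-sigma-algebra, and random variables on a trivial one *)

Section Measurability.
Context {d : measure_display} {Omega : measurableType d} {R : realType}.
Implicit Types (G : set (set Omega)) (f g : Omega -> R).

Lemma measurable_for_lin G f g (a b : R) : sigma_algebra setT G ->
  measurable_for G f -> measurable_for G g ->
  measurable_for G (fun w => a * f w + b * g w).
Proof.
move=> sG mf mg B mB.
(* A sigma-algebra generates itself, so measurability for [G] is ordinary measurability on
   [g_sigma_algebraType G], where closure under sums and products is available. *)
have mG h : measurable_for G h <->
    measurable_fun setT (h : g_sigma_algebraType G -> R).
  split=> mh.
  - move=> _ C mC; rewrite setTI /measurable /= sigma_algebra_id//.
    exact: mh.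
  - move=> C mC; have := mh measurableT C mC.
    by rewrite setTI /measurable /= sigma_algebra_id.
move: B mB; apply/mG; apply: measurable_funD.
- by apply: measurable_funM; [exact: measurable_cst|exact/mG].
- by apply: measurable_funM; [exact: measurable_cst|exact/mG].
Qed.

(* Outside a null set all points have the same rational Dedekind cut. *)
Lemma trivial_ae_cst (P : probability Omega R) G f :
  trivial_mod P G -> G `<=` measurable -> measurable_for G f ->
  exists c, {ae P, forall w, f w = c}.
Proof.
move=> triv Gm mf.
have PT : (0 < P setT)%E by rewrite probability_setT.
(* Every rational bound occurs at its own code; a number that codes no rational gets the default 0,
   which only repeats a half-line. *)
pose E (n : nat) : set Omega :=
  f @^-1` `]-oo, oapp ratr 0 (choice.unpickle n : option rat)].
have GE n : G (E n) by apply: mf; exact: measurable_itv.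
have /boolp.choice[b Eb] :
    forall n, exists b, {ae P, forall w, (w \in E n) = b}.
  move=> n.
  have [P0|P1] := triv _ (GE n).
  - exists false; apply: (@negligibleS _ _ _ _ (E n)).
      by move=> w /=; case: (boolP (w \in E n)) => // /set_mem.
    by apply/negligibleP; first exact: Gm.
  - exists true; apply: (@negligibleS _ _ _ _ (~` E n)).
      by move=> w /= + Ew; rewrite (mem_set Ew).
    apply/negligibleP; first exact/measurableC/Gm.
    have mE : measurable (E n) := Gm _ (GE n).
    transitivity (1 - P (E n))%E; first exact: probability_setC.
    by rewrite P1 subee.
have Eall : {ae P, forall w, forall n, (w \in E n) = b n}.
  exact: (@ae_foralln _ _ _ P (fun n w => (w \in E n) = b n)).
have [w0 Ew0] := @filter_ex _ _ (ae_properfilter_algebraOfSetsType PT) _ Eall.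
exists (f w0); apply: filterS Eall => w Ew.
(* [w] and the reference point [w0] have the same memberships [b], so no rational can separate [f w]
   from [f w0]. *)
have cut (q : rat) : (f w <= ratr q) = (f w0 <= ratr q).
  have := Ew (choice.pickle q); rewrite -Ew0 => H.
  have Eq v : (v \in E (choice.pickle q)) = (f v <= ratr q).
    by apply/idP/idP; rewrite inE /E /= choice.pickleK /= in_itv.
  by rewrite -!Eq.
apply/eqP; case: ltgtP => // /rat_in_itvoo[q]; rewrite in_itv/= => /andP[lq ql].
- by have := cut q; rewrite (ltW lq) leNgt ql.
- by have := cut q; rewrite (ltW lq) leNgt ql.
Qed.

End Measurability.

(** * Stochastic integrals under scaling and addition of a simple integrand *)

Section Integrals.
Context {d : measure_display} {Omega : measurableType d} {R : realType}.
Variables (P : probability Omega R) (Ft : R -> set (set Omega)).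

Lemma holds_outsideS (eta : R) (Q Q' : set Omega) :
  Q `<=` Q' -> holds_outside P eta Q -> holds_outside P eta Q'.
Proof. by move=> QQ' [A [mA PA AQ]]; exists A; split=> // w /AQ /QQ'. Qed.

(** Up to time [u] the integral samples the integrator only at times in [0, u], so a relation known
    only up to [t] is enough. *)
Lemma simple_integral_eq_scale (K : seq (simple_term Ft))
    (X X' : R -> Omega -> R) (a t u : R) w : 0 <= u -> u <= t ->
  (forall v, 0 <= v -> v <= t -> X' v w = a * X v w) ->
  simple_integral K X' u w = a * simple_integral K X u w.
Proof.
move=> u0 ut XX'; rewrite /simple_integral mulr_sumr; apply: eq_bigr => k _.
have s0 := st_start_ge0 k; have e0 := le_trans s0 (st_start_le_end k).
rewrite !XX' ?ge_min ?le_min ?ut ?orbT ?u0 ?s0 ?e0//.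
by rewrite -mulrBr mulrCA.
Qed.

Lemma ucp_cvg_affine (Yn : nat -> R -> Omega -> R) (Y W : R -> Omega -> R)
    (a : R) : 0 < a -> ucp_cvg P Yn Y ->
  ucp_cvg P (fun n t w => a * Yn n t w + W t w) (fun t w => a * Y t w + W t w).
Proof.
move=> a0 cvY t e eta t0 e0 eta0.
have := cvY t (e / a) eta t0 (divr_gt0 e0 a0) eta0.
apply: filterS => n; apply: holds_outsideS => w YnY u u0 ut.
rewrite opprD addrACA subrr addr0 -mulrBr normrM gtr0_norm//.
by rewrite mulrC -ler_pdivlMr//; exact: YnY.
Qed.

(** Once [Wn] and [W] agree up to time [t] they cancel there, leaving [a * (Yn - Y)], which is
    controlled with tolerance [e / a]. Letting [Wn] vary with [n] accommodates a holding that stops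
    at time [n]. *)
Lemma emery_cvg_affine (Yn Wn : nat -> R -> Omega -> R)
    (Y W : R -> Omega -> R) (a : R) : 0 < a -> emery_cvg P Ft Yn Y ->
  (forall t, \forall n \near \oo, forall u w,
     0 <= u -> u <= t -> Wn n u w = W u w) ->
  emery_cvg P Ft (fun n t w => a * Yn n t w + Wn n t w)
    (fun t w => a * Y t w + W t w).
Proof.
move=> a0 cvY WnW t e eta t0 e0 eta0.
have := cvY t (e / a) eta t0 (divr_gt0 e0 a0) eta0.
apply: filterS2 (WnW t) => n Wn_eq cvK K K1.
have := cvK K K1; apply: holds_outsideS => w YnY u u0 ut.
rewrite (@simple_integral_eq_scale _ (fun u w => Yn n u w - Y u w) _ a t)//.
  by rewrite normrM gtr0_norm// mulrC -ler_pdivlMr//; exact: YnY.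
by move=> v v0 vt; rewrite Wn_eq// opprD addrACA subrr addr0 -mulrBr.
Qed.

Definition scale_term (a : R) (k : simple_term Ft) : simple_term Ft :=
  SimpleTerm (a * st_coef k) (st_start_ge0 k) (st_start_le_end k)
    (st_eventP k).

Lemma simple_process_scale_cat a (K K' : seq (simple_term Ft)) t w :
  simple_process (map (scale_term a) K ++ K') t w =
  a * simple_process K t w + simple_process K' t w.
Proof.
rewrite /simple_process big_cat big_map mulr_sumr; congr (_ + _).
by apply: eq_bigr => k _; rewrite -!mulrA.
Qed.

Lemma simple_integral_scale_cat a (K K' : seq (simple_term Ft)) X t w :
  simple_integral (map (scale_term a) K ++ K') X t w =
  a * simple_integral K X t w + simple_integral K' X t w.
Proof.
rewrite /simple_integral big_cat big_map mulr_sumr; congr (_ + _).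
by apply: eq_bigr => k _; rewrite -!mulrA.
Qed.

Lemma simple_process_bound (K : seq (simple_term Ft)) t w :
  `|simple_process K t w| <= \sum_(k <- K) `|st_coef k|.
Proof.
apply: le_trans (ler_norm_sum _ _ _) _; apply: ler_sum => k _.
rewrite !normrM -mulrA ler_piMr// mulr_ile1// !indicE normr_nat.
- by case: (_ \in _).
- by case: (_ \in _).
Qed.

Context {I : choiceType}.

Lemma sum_fset_restrict (F G : {fset I}) (f : I -> R) : (F `<=` G)%fset ->
  \sum_(i <- G) (if i \in F then f i else 0) = \sum_(i <- F) f i.
Proof.
move=> FG; rewrite -(big_fset_incl _ FG)/=; last by move=> i _ /negPf->.
by rewrite !big_seq; apply: eq_bigr => i ->.
Qed.

(** Induction on the closure: simple integrands are combined by concatenating their terms, and in a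
    limit the same simple integrand is added to every approximant. Coordinates of [G] outside [F]
    are cleared because the relation over [F] neither bounds them nor makes them converge. *)
Lemma bounded_integral_add_simple (F G : {fset I}) (X : I -> R -> Omega -> R)
    (a : R) (K : I -> seq (simple_term Ft)) H Y :
  (F `<=` G)%fset -> 0 < a -> bounded_integral P Ft F X H Y ->
  bounded_integral P Ft G X
    (fun i t w => (if i \in F then a * H i t w else 0) +
                  simple_process (K i) t w)
    (fun t w => a * Y t w + \sum_(i <- G) simple_integral (K i) (X i) t w).
Proof.
move=> FG a0; elim=> {H Y} [K0|Hn Yn H Y C _ IH HnC HnH YnY].
- have := bounded_integral_simple P G X
    (fun i => if i \in F then map (scale_term a) (K0 i) ++ K i else K i).
  congr (bounded_integral _ _ _ _ _ _).
  + apply/funext => i; apply/funext => t; apply/funext => w.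
    by case: ifP => _; rewrite ?simple_process_scale_cat ?add0r.
  + apply/funext => t; apply/funext => w.
    rewrite mulr_sumr -(sum_fset_restrict _ FG) -big_split /=.
    apply: eq_bigr => i _.
    by case: ifP => _; rewrite ?simple_integral_scale_cat ?add0r.
- pose C' := a * `|C| + \sum_(i <- G) \sum_(k <- K i) `|st_coef k|.
  apply: (bounded_integral_lim (C := C') IH).
  + move=> n i t w iG t0; apply: le_trans (ler_normD _ _) _; apply: lerD.
      case: ifP => iF; last by rewrite normr0 mulr_ge0// ltW.
      rewrite normrM gtr0_norm// ler_pM2l//.
      exact: le_trans (HnC n i t w iF t0) (ler_norm _).
    apply: le_trans (simple_process_bound _ _ _) _.
    rewrite (big_fsetD1 i)//= lerDl.
    by apply: sumr_ge0 => j _; apply: sumr_ge0 => k _.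
  + move=> i t w iG t0; apply: cvgD; last exact: cvg_cst.
    case: ifP => iF; last exact: cvg_cst.
    by apply: cvgM; [exact: cvg_cst|exact: HnH].
  + exact: ucp_cvg_affine.
Qed.

End Integrals.

(** * Self-financing strategies with an added constant holding *)

Section Strategies.
Context {d : measure_display} {Omega : measurableType d} {R : realType}
  {I : choiceType}.
Variables (P : probability Omega R) (Ft : R -> set (set Omega)).
Hypothesis basis : usual_basis P Ft.
Variable S : I -> R -> Omega -> R.

Lemma ae_ex (Q : Omega -> Prop) : {ae P, forall w, Q w} -> exists w, Q w.
Proof.
have PT : (0 < P setT)%E by rewrite probability_setT.
exact: (@filter_ex _ _ (ae_properfilter_algebraOfSetsType PT)).
Qed.

Lemma predictable_affine (X : R -> Omega -> R) (a c : R) :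
  predictable Ft X -> predictable Ft (fun t w => a * X t w + c).
Proof.
move=> pX B mB; apply: (pX ((fun x => a * x + c) @^-1` B)).
have mf : measurable_fun [set: R] (fun x => a * x + c).
  apply: measurable_funD; last exact: measurable_cst.
  by apply: measurable_funM; [exact: measurable_cst|exact: measurable_id].
by have := mf measurableT B mB; rewrite setTI.
Qed.

Lemma predictable_cst (c : R) :
  predictable Ft (fun (_ : R) (_ : Omega) => c).
Proof.
move=> B _; set D := [set p : R * Omega | _].
have [D0 DC _] :=
  smallest_sigma_algebra D (@predictable_rectangle _ Omega R Ft).
have [Bc|Bc] := pselect (B c).
- rewrite [X in smallest _ _ X](_ : _ = D `\` set0); first exact: DC.
  by rewrite setD0; apply/seteqP; split=> p // [].
- rewrite [X in smallest _ _ X](_ : _ = set0)//.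
  by apply/seteqP; split=> p // [].
Qed.

(* Coordinates outside [F] are reset to 0: an evanescent component of a strategy
   need not be predictable, so it cannot be kept when [i0] joins the support. *)
Definition add_hold (F : {fset I}) (a : R) (i0 : I) (c : R)
    (H : I -> R -> Omega -> R) : I -> R -> Omega -> R :=
  fun i t w => (if i \in F then a * H i t w else 0) +
               (if i == i0 then c else 0).

Lemma sum_fset_eq (F : {fset I}) (i0 : I) (f : I -> R) : i0 \in F ->
  (forall i, i != i0 -> f i = 0) -> \sum_(i <- F) f i = f i0.
Proof.
move=> i0F f0; rewrite (big_fsetD1 i0)//= big_seq big1 ?addr0// => i.
by rewrite !inE => /andP[/f0].
Qed.

(* The constant integrand [c] on ]0, +oo[ is not simple; it is the limit of
   [c] on ]0, n], whose integral agrees with [c (S - S_0)] up to time [n]. *)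
Lemma stoch_integral_add_hold (F : {fset I}) (a : R) (i0 : I) (c : R) H Z :
  0 < a -> stoch_integral P Ft F S H Z ->
  stoch_integral P Ft (i0 |` F)%fset S (add_hold F a i0 c H)
    (fun t w => a * Z t w + c * (S i0 t w - S i0 0 w)).
Proof.
move=> a0 [pH [Hn [Yn [HYn HnH YnZ Z0]]]]; split.
  move=> i _; rewrite /add_hold; case: (boolP (i \in F)) => iF.
    exact: predictable_affine (pH i iF).
  exact: predictable_cst.
have F0T : Ft 0 setT.
  have [G0 GC _] := ub_sigma basis (lexx 0).
  by rewrite -(setD0 setT); exact: GC.
pose hold n i : seq (simple_term Ft) := if i == i0
  then [:: SimpleTerm c (lexx 0) (ler0n R n) F0T] else [::].
have FG : (F `<=` i0 |` F)%fset by exact: fsubsetUr.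
have i0G : i0 \in (i0 |` F)%fset by rewrite fset1U1.
exists (fun n i t w => (if i \in F then a * Hn n i t w else 0) +
                       simple_process (hold n i) t w).
exists (fun n t w => a * Yn n t w +
          \sum_(i <- (i0 |` F)%fset) simple_integral (hold n i) (S i) t w).
split.
- by move=> n; exact: bounded_integral_add_simple.
- move=> i t w iG t0; apply: cvgD.
    case: ifP => iF; last exact: cvg_cst.
    by apply: cvgM; [exact: cvg_cst|exact: HnH].
  apply: cvg_near_cst; near=> n.
  rewrite /simple_process /hold; case: eqP => _; last by rewrite big_nil.
  rewrite big_seq1 /= !indicE in_setT !mulr1 mem_set ?mulr1//=.
  by rewrite in_itv/= t0; near: n; exact: nbhs_infty_ger.
- apply: emery_cvg_affine => // t; near=> n => u w u0 ut.
  rewrite (sum_fset_eq i0G); last first.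
    by move=> i /negPf ii0; rewrite /simple_integral /hold ii0 big_nil.
  rewrite /simple_integral /hold eqxx big_seq1 /= indicE in_setT mulr1.
  (* For [n] beyond [t] the stopping at [n] is invisible on [0, [t]], and the integral over ]0, [u]]
     is [c * (S i0 u w - S i0 0 w)]. *)
  rewrite min_r; last first.
    by apply: le_trans ut _; near: n; exact: nbhs_infty_ger.
  by rewrite min_l.
- by apply: filterS Z0 => w Z0; rewrite Z0 subrr !mulr0 addr0.
Unshelve. all: by end_near. Qed.

(** The holding is worth its initial value plus its gains, so it preserves self-financing. Wealth
    and integral are both taken over the support, so the non-vanishing hypothesis is what puts [i0]
    into the support and fixes the index set. *)
Lemma self_financing_add_hold delta (a : R) (i0 : I) (c : R) :
  let nu := add_hold (fset_set (strategy_support P delta)) a i0 c delta in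
  0 < a -> ~ indist P (nu i0) (fun _ _ => 0) -> self_financing P Ft S delta ->
  self_financing P Ft S nu /\
  wealth P S nu = (fun t w => a * wealth P S delta t w + c * S i0 t w).
Proof.
move=> nu a0 nu0 [[fin _] [Z [HZ wZ]]].
(* Away from [i0] the new component is [a * delta i] or 0, and [a] is nonzero, so it is evanescent
   exactly when [delta i] is. *)
have supp : strategy_support P nu = i0 |` strategy_support P delta.
  apply/seteqP; split => i; rewrite /strategy_support /=.
  - have [->|ii0] := eqVneq i i0; first by left.
    move=> nui; right => di; apply: nui; rewrite /nu /add_hold.
    apply: filterS di => w di t t0; rewrite di// mulr0 (negPf ii0).
    by case: (_ \in _); rewrite addr0.
  - have [-> //|ii0] := eqVneq i i0; move=> [/eqP|di].
      by rewrite (negPf ii0).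
    have iF : i \in fset_set (strategy_support P delta).
      by rewrite in_fset_set// mem_set.
    move=> nui; apply: di; apply: filterS nui => w nui t t0.
    have /eqP := nui t t0; rewrite /nu /add_hold iF (negPf ii0) addr0.
    by rewrite mulf_eq0 gt_eqF//= => /eqP.
have fsupp : fset_set (strategy_support P nu) =
    (i0 |` fset_set (strategy_support P delta))%fset.
  by rewrite supp fset_setU1.
have FG : (fset_set (strategy_support P delta) `<=`
    i0 |` fset_set (strategy_support P delta))%fset by exact: fsubsetUr.
have wnu : wealth P S nu =
    (fun t w => a * wealth P S delta t w + c * S i0 t w).
  apply/funext => t; apply/funext => w; rewrite /wealth fsupp.
  have -> : c * S i0 t w =
      \sum_(i <- (i0 |` fset_set (strategy_support P delta))%fset)
        (if i == i0 then c * S i t w else 0).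
    rewrite (sum_fset_eq (fset1U1 i0 _)) ?eqxx//.
    by move=> i /negPf ->.
  rewrite mulr_sumr -(sum_fset_restrict _ FG) -big_split.
  apply: eq_bigr => i _ /=; rewrite /nu /add_hold mulrDl mulrA.
  by congr (_ + _); [case: (_ \in _)|case: eqP]; rewrite ?mul0r.
split=> //; have HZ' := stoch_integral_add_hold i0 c a0 HZ.
split.
  split; first by rewrite supp finite_setU.
  by exists (fun t w => a * Z t w + c * (S i0 t w - S i0 0 w)); rewrite fsupp.
exists (fun t w => a * Z t w + c * (S i0 t w - S i0 0 w)); rewrite fsupp.
split=> //; rewrite wnu; apply: filterS wZ => w wZ t t0.
by rewrite wZ// mulrDr mulrBr addrACA subrKC.
Qed.

(* The support of the new strategy must be exactly [i0 |` support]; this fails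
   for at most one [b], hence the freedom to enlarge [a]. *)
Lemma Psf_add_hold X (i0 : I) (s0 a : R) : 0 < a -> 0 < s0 ->
  {ae P, forall w, S i0 0 w = s0} -> Psf P Ft S 0 X ->
  exists2 b, a <= b & Psf P Ft S 1 (fun t w => b * X t w + s0^-1 * S i0 t w).
Proof.
move=> a0 s0_gt0 S0 [delta [sf w0 Xw]].
pose nu b := add_hold (fset_set (strategy_support P delta)) b i0 s0^-1 delta.
have [b [b0 ab nub]] :
    exists b, [/\ 0 < b, a <= b & ~ indist P (nu b i0) (fun _ _ => 0)].
  have [nua|nua] := pselect (indist P (nu a i0) (fun _ _ => 0)); last first.
    by exists a.
  (* If the component vanished for both [a] and [a + a], subtracting at time 0 would give
     [a * delta i0 = 0] and hence [s0^-1 = 0]. *)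
  exists (a + a); rewrite addr_gt0// lerDl ltW//; split=> // nuaa.
  have [w [wa waa]] : exists w, nu a i0 0 w = 0 /\ nu (a + a) i0 0 w = 0.
    by apply: ae_ex; apply: filterS2 nua nuaa => w na naa; rewrite na ?naa.
  move: wa waa; rewrite /nu /add_hold eqxx; case: (_ \in _).
    move=> wa; rewrite mulrDl -addrA wa addr0 => ad; move: wa; rewrite ad.
    by rewrite add0r => /eqP; rewrite invr_eq0 gt_eqF.
  by rewrite add0r => /eqP; rewrite invr_eq0 gt_eqF.
exists b => //; exists (nu b).
have [sfnu wnu] := self_financing_add_hold b0 nub sf.
rewrite wnu; split=> //.
- by apply: filterS2 w0 S0 => w -> ->; rewrite mulr0 add0r mulVf// gt_eqF.
- by apply: filterS Xw => w Xw t t0; rewrite Xw.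
Qed.

(** NA is an equality of sets; this serves its easy inclusion. The support is empty, so every sum
    involved is empty. *)
Lemma Psf0_zero : Psf P Ft S 0 (fun _ _ => 0).
Proof.
pose nil : seq (simple_term Ft) := [::].
have supp0 :
    strategy_support P (fun (_ : I) (_ : R) (_ : Omega) => 0 : R) = set0.
  by apply/seteqP; split=> // i; apply; apply: aeW.
have int0 : stoch_integral P Ft fset0 S (fun _ _ _ => 0) (fun _ _ => 0).
  split=> //; exists (fun=> fun=> simple_process nil).
  exists (fun=> fun t w => \sum_(i <- fset0) simple_integral nil (S i) t w).
  split=> //.
  - move=> n; exact: (bounded_integral_simple P fset0 S (fun=> nil)).
  - move=> t e eta _ e0 eta0; near=> n => K _; exists set0.
    split=> // [|w _ u u0 ut]; first by rewrite measure0 lee_fin ltW.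
    rewrite /simple_integral big1 ?normr0 ?ltW// => k _.
    by rewrite !big_seq_fset0 subrr mulr0.
  - exact: aeW.
have w0 : wealth P S (fun _ _ _ => 0) = fun _ _ => 0.
  apply/funext => t; apply/funext => w.
  by rewrite /wealth supp0 fset_set0 big_seq_fset0.
exists (fun _ _ _ => 0); rewrite w0; split; try exact: aeW.
split.
  by rewrite /strategy supp0 fset_set0; split=> //; exists (fun _ _ => 0).
exists (fun _ _ => 0); rewrite supp0 fset_set0 w0; split=> //.
by apply: aeW => w t _; rewrite addr0.
Unshelve. all: by end_near. Qed.

End Strategies.

(** * Measurable versions, estimates of the gauge, and the conclusion *)

Lemma semimartingale_measurable_version (d : measure_display)
    (Omega : measurableType d) (R : realType) (P : probability Omega R)
    (Ft : R -> set (set Omega)) (X : R -> Omega -> R) (t : R) :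
  usual_basis P Ft -> semimartingale P Ft X -> 0 <= t ->
  exists2 f, measurable_for (Ft t) f & {ae P, forall w, X t w = f w}.
Proof.
move=> basis [M [V [[aM _ _] [aV _ _] XMV]]] t0.
(* [semimartingale] gives adaptedness of [M] and [V] and identifies [X] with their sum only up to
   indistinguishability, while [L0] asks for measurability everywhere; the sum itself is therefore
   the version. *)
exists (fun w => 1 * M t w + 1 * V t w).
  exact: measurable_for_lin (ub_sigma basis t0) (aM _ t0) (aV _ t0).
by apply: filterS XMV => w XMV; rewrite XMV// !mul1r.
Qed.

Lemma gauge_le (d : measure_display) (Omega : measurableType d)
    (R : realType) (B : set (Omega -> R)) xi (b : R) : 0 < b ->
  B (fun w => b * xi w) -> (gauge B xi <= (b^-1)%:E)%E.
Proof.
move=> b0 Bxi; apply: ereal_inf_lbound; exists b^-1 => //; split.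
  by rewrite invr_gt0.
exists (fun w => b * xi w) => //; apply/funext => w.
by rewrite mulKf// gt_eqF.
Qed.

Lemma ereal_gt0_dense (R : realType) (g : \bar R) : (0 < g)%E ->
  exists2 a : R, 0 < a & ((a^-1)%:E < g)%E.
Proof.
case: g => [r||//]; last by exists 1 => //; rewrite ltry.
rewrite lte_fin => r0; exists (2 / r); first by rewrite divr_gt0.
by rewrite invf_div lte_fin ltr_pdivrMr// ltr_pMr// ltr1n.
Qed.

Theorem proposition7p28 (d : measure_display) (Omega : measurableType d)
  (R : realType) (P : probability Omega R) (Ft : R -> set (set Omega))
  (basis : usual_basis P Ft) (triv : trivial_mod P (Ft 0))
  (I : choiceType) (S : I -> R -> Omega -> R)
  (S_semimart : forall i, semimartingale P Ft (S i))
  (S_ge0 : forall i, nonneg_process P (S i))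
  (S0_gt0 : exists i, {ae P, forall w, 0 < S i 0 w})
  (T : R) (T_gt0 : 0 < T)
  (K : R -> set (Omega -> R))
  (K_family :
     [\/ (forall alpha : R, 0 <= alpha ->
            K alpha = terminal_values P (Ft T) T (Psf P Ft S alpha)),
         (forall alpha : R, 0 <= alpha ->
            K alpha = terminal_values P (Ft T) T (Psf_adm P Ft S alpha))
       | (forall alpha : R, 0 <= alpha ->
            K alpha = terminal_values P (Ft T) T (Psf_pos P Ft S alpha))]) :
  NA1 P (Ft T) (K 1) -> NA P (Ft T) (K 0).
Proof.
move=> na1; have T0 := ltW T_gt0.
have [i0 Si0] := S0_gt0.
have [s0 s0_gt0 S0] : exists2 s0, 0 < s0 & {ae P, forall w, S i0 0 w = s0}.
  have [f mf Sf] :=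
    semimartingale_measurable_version basis (S_semimart i0) (lexx 0).
  have [c fc] := trivial_ae_cst triv (ub_sub basis (lexx 0)) mf.
  have Sc : {ae P, forall w, S i0 0 w = c}.
    by apply: filterS2 Sf fc => w -> ->.
  exists c => //.
  have [w [Sw <- //]] : exists w, 0 < S i0 0 w /\ S i0 0 w = c.
    by apply: (@ae_ex _ _ _ P); apply: filterS2 Si0 Sc.
have [f mf Sf] := semimartingale_measurable_version basis (S_semimart i0) T0.
(* The three families enter the rest of the argument only through these properties of the set [Q] of
   wealth processes. *)
have [Q [KQ Q_zero Q_add]] : exists Q : R -> set (R -> Omega -> R),
    [/\ forall alpha, 0 <= alpha ->
          K alpha = terminal_values P (Ft T) T (Q alpha),
        Q 0 (fun _ _ => 0)
      & forall X a, 0 < a -> Q 0 X -> exists2 b, a <= b &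
          Q 1 (fun t w => b * X t w + s0^-1 * S i0 t w)].
  have Psf_zero := Psf0_zero P Ft S.
  have s0V : 0 <= s0^-1 by rewrite invr_ge0 ltW.
  case: K_family => KE.
  - exists (Psf P Ft S); split=> // X a a0 X0.
    exact: (Psf_add_hold basis a0 s0_gt0 S0 X0).
  - exists (Psf_adm P Ft S); split=> //.
      by split=> //; exists 0 => //; apply: aeW => w t _; rewrite oppr0.
    move=> X a a0 [X0 [m m0 Xm]].
    have [b ab Qb] := Psf_add_hold basis a0 s0_gt0 S0 X0.
    have b0 := lt_le_trans a0 ab.
    (* The lower bound [- m] of [X] is scaled by [b]; the nonnegative holding of [S i0] cannot
       worsen it. *)
    exists b => //; split=> //; exists (b * m); first by rewrite mulr_ge0// ltW.
    apply: filterS2 Xm (S_ge0 i0) => w Xm S0w t t0.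
    rewrite -mulrN -[leLHS]addr0 lerD// ?mulr_ge0 ?S0w//.
    by rewrite ler_pM2l// Xm.
  - exists (Psf_pos P Ft S); split=> //.
      by split=> //; exact: aeW.
    move=> X a a0 [X0 Xp].
    have [b ab Qb] := Psf_add_hold basis a0 s0_gt0 S0 X0.
    exists b => //; split=> //.
    apply: filterS2 Xp (S_ge0 i0) => w Xp S0w t t0.
    by rewrite addr_ge0// mulr_ge0 ?S0w ?Xp// ltW// (lt_le_trans a0).
have sT := ub_sigma basis T0.
apply/seteqP; split=> xi; last first.
  move=> [mxi xi0]; split; last first.
    by split=> //; apply: filterS xi0 => w ->.
  by rewrite KQ//; split=> //; exists (fun _ _ => 0).
move=> [+ xi_ge0]; rewrite KQ// => -[mxi [X QX xiX]].
apply: contrapT => xi0.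
(* [a] is so large that [a^-1] lies below the gauge of [xi]; any [b >= a] then contradicts the bound
   [b^-1] on that gauge. *)
have [a a0 ag] := ereal_gt0_dense (na1 _ xi_ge0 xi0).
have [b ab Qb] := Q_add X a a0 QX.
have b0 := lt_le_trans a0 ab.
have : (gauge (gaugeB P (Ft T) (K 1%R)) xi <= (b^-1)%:E)%E.
  apply: gauge_le => //; split; last first.
    split; last by apply: filterS xi_ge0.2 => w xiw; rewrite mulr_ge0// ltW.
    have := measurable_for_lin b 0 sT mxi mxi.
    by congr (measurable_for _ _); apply/funext => w; rewrite mul0r addr0.
  (* [b * xi] is this terminal value minus [s0^-1 * f], where [f] is the measurable version of
     [S i0 T], so the subtracted part is in [L0_pos]. *)
  exists (fun w => b * xi w + s0^-1 * f w).
    rewrite KQ//; split; first exact: measurable_for_lin.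
    exists (fun t w => b * X t w + s0^-1 * S i0 t w) => //.
    by apply: filterS2 xiX Sf => w -> ->.
  exists (fun w => s0^-1 * f w); last by apply/funext => w; rewrite addrK.
  split.
    have := measurable_for_lin s0^-1 0 sT mf mf.
    by congr (measurable_for _ _); apply/funext => w; rewrite mul0r addr0.
  apply: filterS2 Sf (S_ge0 i0) => w <- Sw.
  by rewrite mulr_ge0 ?Sw// invr_ge0 ltW.
apply/negP; rewrite -ltNge; apply: le_lt_trans ag.
by rewrite lee_fin lef_pV2.
Qed.
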